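(* Let $D=(X,Y,A)$ be an oriented split graph in which $D[Y]$ is a regular tournament. Write $d^+(v)=|N^+(v)|$ and $d^-(v)=|N^-(v)|$ (in $D$). Then: (A1) for every $x\in X$, $d^{++}_Y(x)\ge d^+(x)$ or $d^{++}_Y(x)\ge d^-(x)$ (or both); (A2) for every $x\in X$, $d^{--}_Y(x)\ge d^-(x)$ or $d^{--}_Y(x)\ge d^+(x)$ (or both); (B1) either there exists $x'\in X$ with $d^{++}_Y(x')\ge d^+(x')$, or $d^{--}_Y(x)\ge d^-(x)$ for all $x\in X$; (B2) either there exists $x'\in X$ with $d^{++}_Y(x')\ge d^-(x')$, or $d^{--}_Y(x)\ge d^+(x)$ for all $x\in X$; (C1) there exists $v\in V(D)$ with $d^{++}(v)\ge d^+(v)$; (C2) there exists $v\in V(D)$ with $d^{++}(v)\ge d^-(v)$.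
   Context: An oriented split graph $D=(X,Y,A)$ is an oriented graph (loopless, no pair of opposite arcs) whose vertex set is partitioned into $X$ and $Y$ with $X$ independent and $D[Y]$ a tournament. A tournament is regular if every vertex has equal in- and out-degree. For a vertex $u$ of $D$: $N^+(u)=\{v:uv\in A\}$, $N^-(u)=\{v:vu\in A\}$, $N^{++}(u)=\{v: uw,wv\in A \text{ for some } w\}\setminus N^+(u)$, $N^{--}(u)=\{v: vw,wu\in A\text{ for some } w\}\setminus N^-(u)$; $d^{++}(u)=|N^{++}(u)|$, $d^{++}_Y(u)=|N^{++}(u)\cap Y|$, $d^{--}_Y(u)=|N^{--}(u)\cap Y|$. *)

(* Defs.v *)
From mathcomp Require Import all_boot.

Set Implicit Arguments.
Unset Strict Implicit.
Unset Printing Implicit Defensive.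

(* A digraph is a finite vertex type T with an arc relation A : rel T;       *)
(* A u v means that uv is an arc.                                            *)

Section Digraph.

Variables (T : finType) (A : rel T).

(* Loopless and without pairs of opposite arcs. *)
Definition oriented : Prop :=
  irreflexive A /\ forall u v : T, ~~ (A u v && A v u).

Definition independent (X : {set T}) : Prop :=
  {in X &, forall u v : T, ~~ A u v}.

(* The subdigraph induced by Y is a tournament. *)
Definition tournament_on (Y : {set T}) : Prop :=
  {in Y, forall u : T, ~~ A u u} /\
  {in Y &, forall u v : T, u != v -> A u v (+) A v u}.

(* The parts X and Y of the vertex set are allowed to be empty. *)
Definition oriented_split (X Y : {set T}) : Prop :=
  [/\ oriented, X :|: Y = [set: T], [disjoint X & Y],
      independent X & tournament_on Y].

Definition outN (u : T) : {set T} := [set v | A u v].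
Definition inN (u : T) : {set T} := [set v | A v u].

Definition outN2 (u : T) : {set T} :=
  [set v | [exists w, A u w && A w v]] :\: outN u.
Definition inN2 (u : T) : {set T} :=
  [set v | [exists w, A v w && A w u]] :\: inN u.

Definition outdeg (u : T) : nat := #|outN u|.
Definition indeg (u : T) : nat := #|inN u|.
Definition outdeg2 (u : T) : nat := #|outN2 u|.

(* Second neighbourhoods are taken in the whole digraph (the middle vertex   *)
(* need not lie in Y) and only then intersected with Y.                      *)
Definition outdeg2_in (Y : {set T}) (u : T) : nat := #|outN2 u :&: Y|.
Definition indeg2_in (Y : {set T}) (u : T) : nat := #|inN2 u :&: Y|.

(* Degrees are those of the subdigraph induced by Y. *)
Definition regular_tournament_on (Y : {set T}) : Prop :=
  tournament_on Y /\
  {in Y, forall v : T, #|outN v :&: Y| = #|inN v :&: Y|}.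

End Digraph.

(* Main.v *)
Require Import Defs.
From mathcomp Require Import all_boot zify.

Set Implicit Arguments.
Unset Strict Implicit.
Unset Printing Implicit Defensive.

(** Call R the set of vertices of Y that lie neither in N^+(x) nor in N^{++}(x):
    every vertex of R dominates N^+(x).  If R is nonempty, some r in R beats at
    least (|R|-1)/2 vertices of R besides all of N^+(x), while regularity gives
    it only (|Y|-1)/2 out-neighbours in Y; hence |R| + 2 |N^+(x)| <= |Y|, which
    says d^{++}_Y(x) >= d^+(x).  If R is empty, d^{++}_Y(x) = |Y| - d^+(x).
    This dichotomy and its dual yield (A) and (B) vertex by vertex.  For (C), if
    no vertex of X works, sum the inequality of (B) over X and count pairs from
    the side of Y: some y in Y has enough second out-neighbours in X, and
    d^{++}_Y(y) is at least the common in- and out-degree in Y. *)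

Lemma card_setI_sum (T : finType) (p : pred T) (W : {set T}) :
  #|[set v | p v] :&: W| = \sum_(v in W) p v.
Proof.
rewrite -sum1_card (eq_bigl (fun v => (v \in W) && p v)); last first.
  by move=> v; rewrite !inE andbC.
by rewrite big_mkcondr; apply: eq_bigr => v _; case: (p v).
Qed.

Lemma sum_outN_inN (T : finType) (A : rel T) (P Q : {set T}) :
  \sum_(u in P) #|outN A u :&: Q| = \sum_(v in Q) #|inN A v :&: P|.
Proof.
under eq_bigr do rewrite card_setI_sum.
by rewrite exchange_big; apply: eq_bigr => v _; rewrite card_setI_sum.
Qed.

Lemma leq_sum_exists (T : finType) (P : {set T}) (f g : T -> nat) :
  P != set0 -> \sum_(u in P) f u <= \sum_(u in P) g u ->
  exists2 u, u \in P & f u <= g u.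
Proof.
move=> /set0Pn[u0 u0P] le_fg; apply/exists_inP; apply: contraLR le_fg.
move=> /exists_inPn lt_gf; rewrite -ltnNge (bigD1 u0) //= [ltnRHS](bigD1 u0) //=.
rewrite -addSn leq_add //; first by rewrite ltnNge lt_gf.
by apply: leq_sum => u /andP[uP _]; rewrite leqNgt; apply: contra (lt_gf u uP) => /ltnW.
Qed.

Lemma card_tournament (T : finType) (A : rel T) (W : {set T}) (v : T) :
  tournament_on A W -> v \in W ->
  #|outN A v :&: W| + #|inN A v :&: W| + 1 = #|W|.
Proof.
move=> [irrA totA] vW.
(* With the 1 written as a cardinal, the identity holds termwise: for each [u] in [W] exactly one of
   [A v u], [A u v], [u == v] is true. *)
have -> : 1 = #|[set u | u == v] :&: W|.
  by rewrite -(cards1 v); apply: eq_card => u; rewrite !inE; case: eqP => // ->.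
rewrite !card_setI_sum -!big_split -sum1_card; apply: eq_bigr => u uW /=.
have [->|neq_uv] := eqVneq u v; first by rewrite (negPf (irrA v vW)).
have := totA v u vW uW; rewrite eq_sym neq_uv => /(_ isT).
by case: (A v u); case: (A u v).
Qed.

Lemma tournament_onS (T : finType) (A : rel T) (W Y : {set T}) :
  W \subset Y -> tournament_on A Y -> tournament_on A W.
Proof.
move=> /subsetP sWY [irrA totA]; split=> [u /sWY|u v /sWY uY /sWY]; first exact: irrA.
exact: totA.
Qed.

Lemma card_dominated (T : finType) (A : rel T) (Y R O : {set T}) :
  regular_tournament_on A Y -> R \subset Y -> O \subset Y -> R != set0 ->
  {in R & O, forall r o, A r o} -> #|R| + 2 * #|O| <= #|Y|.
Proof.
move=> [tY regY] sRY sOY R0 domRO; have tR := tournament_onS sRY tY.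
(* In- and out-degrees within [R] both sum to the number of arcs inside [R]. *)
have [r rR le_r] : exists2 r, r \in R & #|inN A r :&: R| <= #|outN A r :&: R|.
  by apply: leq_sum_exists => //; rewrite sum_outN_inN.
have rY := subsetP sRY r rR.
have := card_tournament tR rR; have := card_tournament tY rY.
have := regY r rY.
suff : #|O| + #|outN A r :&: R| <= #|outN A r :&: Y| by lia.
have dis : O :&: (outN A r :&: R) = set0.
  apply/setP => u; rewrite !inE; apply/negP => /and3P[uO _ uR].
  by have := domRO u u uR uO; rewrite (negPf (tY.1 u (subsetP sRY u uR))).
rewrite -[leqLHS]subn0 -(cards0 T) -dis -cardsU subset_leq_card //.
apply/subsetP => u; rewrite !inE => /orP[uO|/andP[-> /(subsetP sRY)]] //.
by rewrite domRO // (subsetP sOY).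
Qed.

Section Split.

Variables (T : finType) (A : rel T) (X Y : {set T}).
Hypothesis splitD : oriented_split A X Y.
Hypothesis regY : regular_tournament_on A Y.

Lemma outN_sub (x : T) : x \in X -> outN A x \subset Y.
Proof.
case: splitD => _ /setP XY _ indX _ xX; apply/subsetP => v; rewrite inE => xv.
have := XY v; rewrite !inE => /orP[vX|//].
by rewrite (negPf (indX x v xX vX)) in xv.
Qed.

Lemma outdeg2_in_dichotomy (x : T) : x \in X ->
  outdeg A x <= outdeg2_in A Y x \/ outdeg2_in A Y x + outdeg A x = #|Y|.
Proof.
move=> xX; rewrite /outdeg /outdeg2_in.
set O := outN A x; set S := outN2 A x :&: Y.
have sOY : O \subset Y := outN_sub xX.
have disSO : S :&: O = set0.
  by apply/setP => v; rewrite !inE; case: (A x v); rewrite ?andbF.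
have cardSO : #|S :|: O| = #|S| + #|O| by rewrite cardsU disSO cards0 subn0.
have sSOY : S :|: O \subset Y by rewrite subUset subsetIr.
have cardY : #|Y :\: (S :|: O)| + #|S :|: O| = #|Y|.
  by rewrite -[in RHS](cardsID (S :|: O)) (setIidPr sSOY) addnC.
have [R0|R0] := eqVneq (Y :\: (S :|: O)) set0.
  by right; rewrite -cardSO -cardY R0 cards0.
left; suff : #|Y :\: (S :|: O)| + 2 * #|O| <= #|Y| by lia.
(* An arc from [o] in [O] to a remaining vertex [r] would put [r] in [S], so the arc goes from [r]
   to [o]. *)
apply: (card_dominated regY) => //; first exact: subsetDl.
move=> r o; rewrite !inE negb_or => /andP[/andP[nSr nOr] rY] xo.
have oY : o \in Y by rewrite (subsetP sOY) ?inE.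
have neq_or : o != r by apply: contra nOr => /eqP <-.
have := regY.1.2 o r oY rY neq_or; case or: (A o r); last by [].
by move: nSr; rewrite nOr rY andbT /=; case: existsP => // -[]; exists o; rewrite xo.
Qed.

(** Serves to turn the equality case of the dichotomy into a comparison with the opposite degree. *)
Lemma outdeg_indeg_leq (x : T) : x \in X -> inN A x \subset Y ->
  outdeg A x + indeg A x <= #|Y|.
Proof.
move=> xX sIY; have [[_ asymA] _ _ _ _] := splitD.
have dis : outN A x :&: inN A x = set0.
  by apply/setP => v; rewrite !inE (negPf (asymA x v)).
rewrite -[leqLHS]subn0 -(cards0 T) -dis -cardsU subset_leq_card //.
by rewrite subUset outN_sub.
Qed.

(** By regularity it suffices that each in-neighbour [z] of [y] in [Y] is a second out-neighbour.
    Otherwise [z] dominates [y] and all its out-neighbours in [Y], which is one vertex too many: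
    with d the common degree of [y] in [Y], [card_dominated] would give 1 + 2(d + 1) <= 2d + 1. *)
Lemma outdeg2_in_tournament (y : T) : y \in Y ->
  #|outN A y :&: Y| <= outdeg2_in A Y y.
Proof.
move=> yY; have [[_ asymA] _ _ _ _] := splitD.
rewrite (regY.2 y yY); apply/subset_leq_card/subsetP => z; rewrite !inE.
move=> /andP[zy zY]; rewrite zY andbT; apply/andP; split.
  by apply: contraL zy => yz; have := asymA y z; rewrite yz.
apply: contraT => /existsPn no_path.
have : #|[set z]| + 2 * #|y |: (outN A y :&: Y)| <= #|Y|.
  apply: (card_dominated regY).
  - by rewrite sub1set.
  - by rewrite subUset sub1set yY subsetIr.
  - by rewrite -card_gt0 cards1.
  move=> _ o /set1P-> /setU1P[-> //|]; rewrite !inE => /andP[yo oY].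
  have neq_oz : o != z.
    by apply: contraTneq yo => ->; have := asymA y z; rewrite zy andbT.
  have := regY.1.2 o z oY zY neq_oz.
  by have := no_path o; rewrite yo /= => /negPf->.
rewrite cards1 cardsU1 !inE (negPf (regY.1.1 y yY)) /=.
have := card_tournament regY.1 yY; have := regY.2 y yY; lia.
Qed.

Lemma cardsI_split (W : {set T}) : #|W| = #|W :&: X| + #|W :&: Y|.
Proof.
have [_ XY /setDidPl disXY _ _] := splitD.
rewrite -(cardsID X W); congr (_ + _); apply: eq_card => v.
have /setP/(_ v) := XY; have /setP/(_ v) := disXY.
by rewrite !inE; case: (v \in X); case: (v \in Y); case: (v \in W).
Qed.

(* [B] is to be instantiated with [A] and with its converse. *)
Lemma outdeg2_average (B : rel T) :
  Y != set0 ->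
  {in Y, forall y, #|outN B y :&: Y| <= #|outN A y :&: Y|} ->
  {in X, forall x, indeg B x <= indeg2_in A Y x} ->
  exists v, outdeg B v <= outdeg2 A v.
Proof.
move=> Y0 leBA le_in.
(* Viewing second out-neighbourhood as a relation lets [sum_outN_inN] count its pairs between [X]
   and [Y] from either side. *)
pose A2 : rel T := fun u v => v \in outN2 A u.
have inA2 x : inN A2 x = inN2 A x by apply/setP => v; rewrite !inE /A2 !inE.
have outA2 y : outN A2 y = outN2 A y by apply/setP => v; rewrite inE.
have [y yY le_y] :
    exists2 y, y \in Y & #|outN B y :&: X| <= #|outN A2 y :&: X|.
  apply: leq_sum_exists => //; rewrite (sum_outN_inN B) (sum_outN_inN A2).
  apply: leq_sum => x xX.
  rewrite inA2; apply: leq_trans (le_in x xX).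
  exact/subset_leq_card/subsetIl.
exists y; rewrite /outdeg /outdeg2 (cardsI_split (outN B y)) (cardsI_split (outN2 A y)).
rewrite -outA2 leq_add // outA2.
exact: leq_trans (leBA y yY) (outdeg2_in_tournament yY).
Qed.

End Split.

(** Reversing all arcs transfers the dichotomy to in-degrees. *)
Lemma oriented_split_converse (T : finType) (A : rel T) (X Y : {set T}) :
  oriented_split A X Y -> oriented_split (fun u v => A v u) X Y.
Proof.
case=> [[irrA asymA] XY disXY indX [irrY totY]]; split=> //.
- by move=> u v uX vX; exact: indX vX uX.
- by split=> // u v uY vY neq_uv; apply: totY; rewrite // eq_sym.
Qed.

Lemma regular_tournament_on_converse (T : finType) (A : rel T) (Y : {set T}) :
  regular_tournament_on A Y -> regular_tournament_on (fun u v => A v u) Y.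
Proof.
case=> [[irrY totY] regY]; split; last by move=> v vY; rewrite [RHS]regY.
by split=> // u v uY vY neq_uv; apply: totY; rewrite // eq_sym.
Qed.

Lemma indeg2_in_converse (T : finType) (A : rel T) (Y : {set T}) (u : T) :
  outdeg2_in (fun u v => A v u) Y u = indeg2_in A Y u.
Proof.
apply: eq_card => v; rewrite !inE; congr (_ && _ && _).
by apply: eq_existsb => w; rewrite andbC.
Qed.

Theorem theorem4p5 (T : finType) (A : rel T) (X Y : {set T})
    (T_nonempty : 0 < #|T|)
    (splitD : oriented_split A X Y)
    (regY : regular_tournament_on A Y) :
  (forall x : T, x \in X ->
     outdeg2_in A Y x >= outdeg A x \/ outdeg2_in A Y x >= indeg A x) /\
  (forall x : T, x \in X ->
     indeg2_in A Y x >= indeg A x \/ indeg2_in A Y x >= outdeg A x) /\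
  ((exists x' : T, x' \in X /\ outdeg2_in A Y x' >= outdeg A x') \/
   (forall x : T, x \in X -> indeg2_in A Y x >= indeg A x)) /\
  ((exists x' : T, x' \in X /\ outdeg2_in A Y x' >= indeg A x') \/
   (forall x : T, x \in X -> indeg2_in A Y x >= outdeg A x)) /\
  (exists v : T, outdeg2 A v >= outdeg A v) /\
  (exists v : T, outdeg2 A v >= indeg A v).
Proof.
have splitC := oriented_split_converse splitD.
have regC := regular_tournament_on_converse regY.
have dich x : x \in X ->
    [/\ outdeg A x <= outdeg2_in A Y x \/ outdeg2_in A Y x + outdeg A x = #|Y|,
        indeg A x <= indeg2_in A Y x \/ indeg2_in A Y x + indeg A x = #|Y|
      & outdeg A x + indeg A x <= #|Y|].
  move=> xX; split; first exact: (outdeg2_in_dichotomy splitD regY xX).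
    by have := outdeg2_in_dichotomy splitC regC xX; rewrite indeg2_in_converse.
  exact: (outdeg_indeg_leq splitD xX (outN_sub splitC xX)).
have B1 : (exists x, x \in X /\ outdeg2_in A Y x >= outdeg A x) \/
    (forall x, x \in X -> indeg2_in A Y x >= indeg A x).
  have [/exists_inP[x]|/exists_inPn no_x] :=
    boolP [exists x in X, outdeg A x <= outdeg2_in A Y x]; first by left; exists x.
  (* Here d^{++}_Y(x) < d^+(x), so the dichotomy forces 2 d^+(x) > |Y|. Hence 2 d^-(x) < |Y|, and
     both dual alternatives give the bound. *)
  by right=> x xX; have [] := dich x xX; have := no_x x xX; lia.
have B2 : (exists x, x \in X /\ outdeg2_in A Y x >= indeg A x) \/
    (forall x, x \in X -> indeg2_in A Y x >= outdeg A x).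
  have [/exists_inP[x]|/exists_inPn no_x] :=
    boolP [exists x in X, indeg A x <= outdeg2_in A Y x]; first by left; exists x.
  (* The equality case would give d^{++}_Y(x) >= d^-(x), so d^+(x) <= d^{++}_Y(x) < d^-(x), and both
     dual alternatives suffice. *)
  by right=> x xX; have [] := dich x xX; have := no_x x xX; lia.
have le_outdeg2 x : outdeg2_in A Y x <= outdeg2 A x.
  exact/subset_leq_card/subsetIl.
split; first by move=> x /dich[]; lia.
split; first by move=> x /dich[]; lia.
split=> //; split=> //.
(* Averaging over [Y] needs a vertex there; if [Y] is empty, every vertex lies in [X] and has both
   degrees 0. *)
have [Y0|Y0] := eqVneq Y set0.
  have /card_gt0P[x _] := T_nonempty.
  have xX : x \in X by case: splitD => _ /setP/(_ x); rewrite Y0 !inE orbF.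
  by have [_ _] := dich x xX; rewrite Y0 cards0; split; exists x; lia.
split.
  case: B1 => [[x [_ le_x]]|le_in]; first by exists x; apply: leq_trans le_x _.
  exact: (outdeg2_average splitD regY (B := A)).
case: B2 => [[x [_ le_x]]|le_in]; first by exists x; apply: leq_trans le_x _.
(* For the converse relation, [outdeg] is [indeg A] and [indeg] is [outdeg A]. *)
apply: (outdeg2_average splitD regY (B := fun u v => A v u)) => // y yY.
by rewrite (regY.2 y yY).
Qed.
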